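(* Let $L\colon\mathsf{Set}\to\mathsf{Mod}(\mathsf{SLAT})$, $R\colon\mathsf{Mod}(\mathsf{SLAT})\to\mathsf{Set}$, $L\dashv R$, be the adjunction whose associated monad is $2^{(-)}\colon\mathsf{Set}\to\mathsf{Set}$. Then there is a left adjoint $$F_{\mathsf{SLAT}}\colon\mathsf{SLAT}\text{-}\mathsf{Net}\to\mathsf{Mod}(\mathsf{SLAT},\mathsf{Cat})$$ which sends an elementary net system $P=(s,t\colon T\to 2^S)$ to the $\mathsf{SLAT}$-category $F_{\mathsf{SLAT}}(P)$ with objects given by $2^S$ and with morphisms generated inductively by the rules: - for every transition $\tau\in T$, a morphism $\tau\colon s(\tau)\to t(\tau)$ is included; - for every pair of morphisms $f\colon x\to y$ and $g\colon x'\to y'$, their sum $f+g\colon x+x'\to y+y'$ is included; - for every pair of morphisms $f\colon x\to y$ and $g\colon y\to z$, their composite $g\circ f\colon x\to z$ is included; - these morphisms are quotiented to satisfy the axioms of an idempotent commutative monoid and of a category; - these morphisms are quotiented to make composition and the assignment of identities monoid homomorphisms. For a morphism of $\mathsf{SLAT}$-nets $(f\colon T\to T',\,g\colon S\to S')$ from $P$ to $P'$, $F_{\mathsf{SLAT}}(f,g)\colon F_{\mathsf{SLAT}}(P)\to F_{\mathsf{SLAT}}(P')$ is the functor given by $2^g$ on objects and by the unique monoidal and functorial extension of $f$ on morphisms.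
   Context: $\mathsf{SLAT}$ is the Lawvere theory of semi-lattices, i.e. commutative idempotent monoids; $\mathsf{Mod}(\mathsf{SLAT})$ is its category of models in $\mathsf{Set}$, $R$ is the underlying-set functor and $L$ the free-model functor. $\mathsf{Mod}(\mathsf{SLAT},\mathsf{Cat})$ is the category of product-preserving functors $\mathsf{SLAT}\to\mathsf{Cat}$ and natural transformations; its objects, called $\mathsf{SLAT}$-categories, are equivalently categories internal to $\mathsf{Mod}(\mathsf{SLAT})$. For a set $X$, $2^X$ denotes the power set of $X$. The monad on $\mathsf{Set}$ corresponding to $\mathsf{SLAT}$ is taken to be the covariant power set monad $2^{(-)}\colon\mathsf{Set}\to\mathsf{Set}$, which sends a set $X$ to its power set $2^X$ and a function $g\colon X\to Y$ to the map $2^g\colon 2^X\to 2^Y$ sending each subset of $X$ to its image. The semi-lattice operation is written $+$. An elementary net system ($\mathsf{SLAT}$-net) is a pair of functions $s,t\colon T\to 2^S$, with $T$ a set (of transitions) and $S$ a set (of places). A morphism from $(s,t\colon T\to 2^S)$ to $(s',t'\colon T'\to 2^{S'})$ is a pair of functions $(f\colon T\to T',\,g\colon S\to S')$ with $s'\circ f=2^g\circ s$ and $t'\circ f=2^g\circ t$. These form the category $\mathsf{SLAT}\text{-}\mathsf{Net}$.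
   Formalization: 2^X is taken to be the set of finite subsets of X (all subsets when X is finite), since the free semi-lattice on X consists of finite subsets and with the full power set neither the adjunction nor the left adjoint exists (e.g. for no transitions and places N). *)

(* Defs.v *)
From HB Require Import structures.
From mathcomp Require Import all_boot.
From mathcomp Require Import boolp classical_sets functions cardinality.

Set Implicit Arguments.
Unset Strict Implicit.
Unset Printing Implicit Defensive.

Local Open Scope classical_set_scope.
Local Open Scope quotient_scope.

(** * Categories, functors, adjunctions *)

Declare Scope cat_scope.
Delimit Scope cat_scope with cat.
Local Open Scope cat_scope.
Reserved Notation "g \oc f" (at level 50, left associativity).

Record category := Category {
  ob :> Type;
  hom : ob -> ob -> Type;
  idm : forall x, hom x x;
  comp : forall x y z, hom y z -> hom x y -> hom x z;
  comp1m : forall x y (f : hom x y), comp (idm y) f = f;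
  compm1 : forall x y (f : hom x y), comp f (idm x) = f;
  compmA : forall w x y z (h : hom y z) (g : hom x y) (f : hom w x),
    comp h (comp g f) = comp (comp h g) f
}.
Arguments hom {c} x y.
Arguments idm {c} x.
Arguments comp {c x y z} g f.
Notation "g \oc f" := (comp g f) : cat_scope.

Definition is_iso (C : category) (x y : C) (f : hom x y) : Prop :=
  exists g : hom y x, g \oc f = idm x /\ f \oc g = idm y.

Record functor (C D : category) := Functor {
  fob :> C -> D;
  fmap : forall x y, hom x y -> hom (fob x) (fob y);
  fmap_id : forall x, fmap (idm x) = idm (fob x);
  fmap_comp : forall x y z (g : hom y z) (f : hom x y),
    fmap (g \oc f) = fmap g \oc fmap f
}.
Arguments fmap {C D} _ {x y} _.

Record nattrans (C D : category) (F G : functor C D) := NatTrans {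
  component :> forall x, hom (F x) (G x);
  naturality : forall x y (f : hom x y),
    component y \oc fmap F f = fmap G f \oc component x
}.

Record adjunction (C D : category) (F : functor C D) (U : functor D C) :=
  Adjunction {
  adj_r : forall x y, hom (F x) y -> hom x (U y);
  adj_l : forall x y, hom x (U y) -> hom (F x) y;
  adj_rK : forall x y, cancel (@adj_r x y) (@adj_l x y);
  adj_lK : forall x y, cancel (@adj_l x y) (@adj_r x y);
  adj_nat : forall x x' y y' (h : hom x' x) (f : hom (F x) y) (k : hom y y'),
    adj_r (k \oc f \oc fmap F h) = fmap U k \oc adj_r f \oc h
}.

Definition adj_unit (C D : category) (F : functor C D) (U : functor D C)
  (a : adjunction F U) (x : C) : hom x (U (F x)) := adj_r a (idm (F x)).

Definition adj_counit (C D : category) (F : functor C D) (U : functor D C)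
  (a : adjunction F U) (y : D) : hom (F (U y)) y := adj_l a (idm (U y)).

Definition is_left_adjoint (C D : category) (F : functor C D) : Prop :=
  exists U : functor D C, inhabited (adjunction F U).

(** * Finite products *)

Definition is_product (C : category) (n : nat) (x : 'I_n -> C) (p : C)
    (pi : forall i, hom p (x i)) : Prop :=
  forall (y : C) (f : forall i, hom y (x i)),
    exists! h : hom y p, forall i, pi i \oc h = f i.

Definition preserves_products (C D : category) (F : functor C D) : Prop :=
  forall (n : nat) (x : 'I_n -> C) (p : C) (pi : forall i, hom p (x i)),
    is_product pi -> is_product (fun i => fmap F (pi i)).

(** * The categories of sets and of small categories *)

Definition SET : category.
Proof.
by refine (@Category Type (fun X Y => X -> Y) (fun X x => x)
             (fun X Y Z g f x => g (f x)) _ _ _).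
Defined.

(* A small category is a set of objects and a set of arrows, with composition
   defined on composable pairs.  With a single set of arrows, an equation
   between arrows whose ends are only provably equal is an ordinary equation. *)
Record smallcat := SmallCat {
  obj : Type;
  arr : Type;
  dom : arr -> obj;
  cod : arr -> obj;
  ident : obj -> arr;
  compose : forall g f : arr, dom g = cod f -> arr;
  dom_ident : forall x, dom (ident x) = x;
  cod_ident : forall x, cod (ident x) = x;
  dom_compose : forall g f (e : dom g = cod f), dom (compose e) = dom f;
  cod_compose : forall g f (e : dom g = cod f), cod (compose e) = cod g;
  compose1f : forall f (e : dom (ident (cod f)) = cod f), compose e = f;
  composef1 : forall f (e : dom f = cod (ident (dom f))), compose e = f;
  composeA : forall h g f (e1 : dom g = cod f) (e2 : dom h = cod (compose e1))
      (e3 : dom h = cod g) (e4 : dom (compose e3) = cod f),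
    compose e2 = compose e4
}.
Arguments dom {s} _.
Arguments cod {s} _.
Arguments ident {s} _.
Arguments compose {s} g f _.

Record catfun (C D : smallcat) := CatFun {
  on_obj : obj C -> obj D;
  on_arr : arr C -> arr D;
  dom_on_arr : forall f, dom (on_arr f) = on_obj (dom f);
  cod_on_arr : forall f, cod (on_arr f) = on_obj (cod f);
  on_arr_ident : forall x, on_arr (ident x) = ident (on_obj x);
  on_arr_compose : forall g f (e : dom g = cod f)
      (e' : dom (on_arr g) = cod (on_arr f)),
    on_arr (compose g f e) = compose (on_arr g) (on_arr f) e'
}.

Lemma catfun_eq (C D : smallcat) (F G : catfun C D) :
  on_obj F =1 on_obj G -> on_arr F =1 on_arr G -> F = G.
Proof.
case: F G => [Fo Fa ? ? ? ?] [Go Ga ? ? ? ?] /= /funext eo /funext ea.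
by subst; f_equal; exact: Prop_irrelevance.
Qed.

Definition catfun_id (C : smallcat) : catfun C C.
Proof.
by refine (@CatFun C C id id _ _ _ _) => // g f e e'; congr compose;
   exact: Prop_irrelevance.
Defined.

Definition catfun_comp (C D E : smallcat) (G : catfun D E) (F : catfun C D) :
  catfun C E.
Proof.
refine (@CatFun C E (on_obj G \o on_obj F) (on_arr G \o on_arr F) _ _ _ _).
- by move=> f /=; rewrite !dom_on_arr.
- by move=> f /=; rewrite !cod_on_arr.
- by move=> x /=; rewrite !on_arr_ident.
- move=> g f e e' /=.
  have e1 : dom (on_arr F g) = cod (on_arr F f).
    by rewrite dom_on_arr cod_on_arr e.
  by rewrite (on_arr_compose _ e1) (on_arr_compose _ e').
Defined.

Definition CAT : category.
Proof.
by refine (@Category smallcat catfun catfun_id catfun_comp _ _ _) => *;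
   exact: catfun_eq.
Defined.

(** * The covariant power set monad *)

(* Subsets are required to be finite: the free commutative idempotent monoid on
   X is the set of finite subsets of X.  For finite X these are all subsets. *)
Definition pow (X : Type) : Type := {A : set X | finite_set A}.

Lemma pow_eq (X : Type) (A B : pow X) : sval A = sval B -> A = B.
Proof. by case: A B => [A a] [B b] /= ?; exact: eq_exist. Qed.

Definition pow_map (X Y : Type) (g : X -> Y) (A : pow X) : pow Y :=
  exist _ (g @` sval A) (finite_image g (svalP A)).

Definition pow_unit (X : Type) (x : X) : pow X := exist _ [set x] (finite_set1 x).

Definition pow_join (X : Type) (AA : pow (pow X)) : pow X :=
  exist _ (\bigcup_(A in sval AA) sval A)
    (bigcup_finite (svalP AA) (fun A _ => svalP A)).

Lemma finite_setU2 (X : Type) (A B : pow X) : finite_set (sval A `|` sval B).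
Proof. by rewrite finite_setU; split; exact: svalP. Qed.

Definition pow_add (X : Type) (A B : pow X) : pow X :=
  exist _ (sval A `|` sval B) (finite_setU2 A B).

Definition pow_zero (X : Type) : pow X := exist _ set0 (finite_set0 X).

Lemma pow_addA (X : Type) : associative (@pow_add X).
Proof. by move=> A B C; apply: pow_eq; exact: setUA. Qed.

Lemma pow_addC (X : Type) : commutative (@pow_add X).
Proof. by move=> A B; apply: pow_eq; exact: setUC. Qed.

Lemma pow_add0 (X : Type) : left_id (@pow_zero X) (@pow_add X).
Proof. by move=> A; apply: pow_eq; exact: set0U. Qed.

Lemma pow_addxx (X : Type) : idempotent_op (@pow_add X).
Proof. by move=> A; apply: pow_eq; exact: setUid. Qed.

Lemma pow_map_id (X : Type) (A : pow X) : pow_map id A = A.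
Proof. by apply: pow_eq; exact: image_id. Qed.

Lemma pow_map_comp (X Y Z : Type) (h : Y -> Z) (g : X -> Y) (A : pow X) :
  pow_map (h \o g) A = pow_map h (pow_map g A).
Proof. by apply: pow_eq; rewrite /= image_comp. Qed.

(** * The Lawvere theory SLAT and its models *)

(* An n-ary operation of SLAT is an element of the free semi-lattice on n
   generators: the sum of a set of variables.  A morphism n -> m is an m-tuple
   of n-ary operations, and composition is substitution. *)
Definition SLAT : category.
Proof.
refine (@Category nat (fun n m => 'I_m -> {set 'I_n}) (fun n i => [set i]%SET)
  (fun n m k g f i => (\bigcup_(j in g i) f j)%SET) _ _ _).
- by move=> n m f; apply: funext => i; rewrite finset.big_set1.
- move=> n m f; apply: funext => i; apply/setP => j.
  apply/finset.bigcupP/idP => [[k kf]|jf]; first by rewrite inE => /eqP ->.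
  by exists j; rewrite // inE.
- move=> n m k l h g f; apply: funext => i; apply/setP => a.
  apply/finset.bigcupP/finset.bigcupP => [[b bh]|[c]].
    by move=> /finset.bigcupP[c cg af]; exists c => //;
       apply/finset.bigcupP; exists b.
  by move=> /finset.bigcupP[b bh cg] af; exists b => //;
     apply/finset.bigcupP; exists c.
Defined.

Definition slat_proj (n : nat) (i : 'I_n) : @hom SLAT n 1%N := fun=> [set i]%SET.
Definition slat_add : @hom SLAT 2%N 1%N := fun=> [set: 'I_2]%SET.
Definition slat_zero : @hom SLAT 0%N 1%N := fun=> finset.set0.

Record model (D : category) := Model {
  model_fun :> functor SLAT D;
  model_prod : preserves_products model_fun
}.

Lemma nattrans_eq (C D : category) (F G : functor C D) (a b : nattrans F G) :
  (forall x, a x = b x) -> a = b.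
Proof.
case: a b => [a na] [b nb] /= ab.
have ? : a = b by exact: functional_extensionality_dep.
by subst; congr NatTrans; exact: Prop_irrelevance.
Qed.

Definition nattrans_id (C D : category) (F : functor C D) : nattrans F F.
Proof.
by refine (@NatTrans C D F F (fun x => idm (F x)) _) => x y f;
   rewrite comp1m compm1.
Defined.

Definition nattrans_comp (C D : category) (F G H : functor C D)
  (b : nattrans G H) (a : nattrans F G) : nattrans F H.
Proof.
refine (@NatTrans C D F H (fun x => b x \oc a x) _) => x y f.
by rewrite -compmA naturality compmA naturality compmA.
Defined.

Definition Mod (D : category) : category.
Proof.
refine (@Category (model D) (fun M N => nattrans M N)
  (fun M => nattrans_id M) (fun M N K b a => nattrans_comp b a) _ _ _).
- by move=> M N a; apply: nattrans_eq => x /=; exact: comp1m.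
- by move=> M N a; apply: nattrans_eq => x /=; exact: compm1.
- by move=> M N K H c b a; apply: nattrans_eq => x /=; exact: compmA.
Defined.

Definition underlying (D : category) : functor (Mod D) D.
Proof.
by refine (@Functor (Mod D) D (fun M : model D => M 1%N)
  (fun M N (a : nattrans M N) => a 1%N) _ _).
Defined.

(* The monad of L -| R is isomorphic to the power set monad: theta is a natural
   bijection compatible with the units and the multiplications. *)
Definition monad_is_pow (L : functor SET (Mod SET)) (R : functor (Mod SET) SET)
    (a : adjunction L R) : Prop :=
  exists theta : forall X : Type, pow X -> R (L X),
    [/\ forall X, bijective (theta X),
        forall (X Y : Type) (g : X -> Y) (A : pow X),
          theta Y (pow_map g A) = fmap R (@fmap _ _ L X Y g) (theta X A),
        forall (X : Type) (x : X), theta X (pow_unit x) = adj_unit a X x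
      & forall (X : Type) (AA : pow (pow X)),
          theta X (pow_join AA) =
          fmap R (adj_counit a (L X)) (theta (R (L X)) (pow_map (theta X) AA))].

(** * Elementary net systems *)

Record net := Net {
  transition : Type;
  place : Type;
  source : transition -> pow place;
  target : transition -> pow place
}.
Arguments source {n} _.
Arguments target {n} _.

Record net_hom (P Q : net) := NetHom {
  on_transition : transition P -> transition Q;
  on_place : place P -> place Q;
  source_hom : forall tau,
    source (on_transition tau) = pow_map on_place (source tau);
  target_hom : forall tau,
    target (on_transition tau) = pow_map on_place (target tau)
}.

Lemma net_hom_eq (P Q : net) (h k : net_hom P Q) :
  on_transition h =1 on_transition k -> on_place h =1 on_place k -> h = k.
Proof.
case: h k => [f g ? ?] [f' g' ? ?] /= /funext ef /funext eg.
by subst; f_equal; exact: Prop_irrelevance.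
Qed.

Definition net_id (P : net) : net_hom P P.
Proof.
by refine (@NetHom P P id id _ _) => tau; rewrite pow_map_id.
Defined.

Definition net_comp (P Q K : net) (k : net_hom Q K) (h : net_hom P Q) :
  net_hom P K.
Proof.
refine (@NetHom P K (on_transition k \o on_transition h)
          (on_place k \o on_place h) _ _) => tau /=.
- by rewrite !source_hom pow_map_comp.
- by rewrite !target_hom pow_map_comp.
Defined.

Definition SLATNet : category.
Proof.
by refine (@Category net net_hom net_id net_comp _ _ _) => *;
   exact: net_hom_eq.
Defined.

(** * SLAT-categories as internal categories *)

Record semilattice (T : Type) := Semilattice {
  sadd : T -> T -> T;
  szero : T;
  saddA : associative sadd;
  saddC : commutative sadd;
  sadd0 : left_id szero sadd;
  saddxx : idempotent_op sadd
}.

Definition semilattice_hom (T U : Type) (a : semilattice T) (b : semilattice U)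
    (f : T -> U) : Prop :=
  {morph f : x y / sadd a x y >-> sadd b x y} /\ f (szero a) = szero b.

(* A category internal to semi-lattices; the last two fields say that
   composition is a homomorphism on the semi-lattice of composable pairs. *)
Record slatcat := SlatCat {
  slat_base :> smallcat;
  slat_obj : semilattice (obj slat_base);
  slat_arr : semilattice (arr slat_base);
  dom_slat : semilattice_hom slat_arr slat_obj dom;
  cod_slat : semilattice_hom slat_arr slat_obj cod;
  ident_slat : semilattice_hom slat_obj slat_arr ident;
  compose_sadd : forall (g f g' f' : arr slat_base)
      (e : dom g = cod f) (e' : dom g' = cod f')
      (e'' : dom (sadd slat_arr g g') = cod (sadd slat_arr f f')),
    compose _ _ e'' = sadd slat_arr (compose g f e) (compose g' f' e');
  compose_szero : forall e : dom (szero slat_arr) = cod (szero slat_arr),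
    compose _ _ e = szero slat_arr
}.

Record slatfun (C D : slatcat) := SlatFun {
  slat_catfun :> catfun C D;
  on_obj_slat : semilattice_hom (slat_obj C) (slat_obj D) (on_obj slat_catfun);
  on_arr_slat : semilattice_hom (slat_arr C) (slat_arr D) (on_arr slat_catfun)
}.

(* phi identifies the product-preserving functor M : SLAT -> Cat with the
   internal category C: it is an isomorphism from C to M(1) that carries the
   semi-lattice operations of C to the ones that M(2) -> M(1) and M(0) -> M(1)
   induce on M(1); w stands for the pair (phi x, phi y) in M(2) = M(1) x M(1),
   respectively for the empty tuple in M(0) = 1. *)
Definition identifies (M : model CAT) (C : slatcat) (phi : catfun C (M 1%N)) :
    Prop :=
  [/\ @is_iso CAT C (M 1%N) phi,
      forall (x y : obj C) (w : obj (M 2%N)),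
        on_obj (fmap M (slat_proj ord0)) w = on_obj phi x ->
        on_obj (fmap M (slat_proj ord_max)) w = on_obj phi y ->
        on_obj (fmap M slat_add) w = on_obj phi (sadd (slat_obj C) x y),
      forall (f g : arr C) (w : arr (M 2%N)),
        on_arr (fmap M (slat_proj ord0)) w = on_arr phi f ->
        on_arr (fmap M (slat_proj ord_max)) w = on_arr phi g ->
        on_arr (fmap M slat_add) w = on_arr phi (sadd (slat_arr C) f g),
      forall w : obj (M 0%N),
        on_obj (fmap M slat_zero) w = on_obj phi (szero (slat_obj C))
    & forall w : arr (M 0%N),
        on_arr (fmap M slat_zero) w = on_arr phi (szero (slat_arr C))].

(** * The SLAT-category generated by a net *)

(* The identities and the unit of the monoid of morphisms are generators too,
   since the axioms of a category and of a monoid refer to them. *)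
Inductive term (P : net) : pow (place P) -> pow (place P) -> Type :=
| Gen (tau : transition P) : term (source tau) (target tau)
| Id (x : pow (place P)) : term x x
| Zero : term (@pow_zero (place P)) (@pow_zero (place P))
| Add x y x' y' (f : term x y) (g : term x' y') :
    term (pow_add x x') (pow_add y y')
| Comp x y z (g : term y z) (f : term x y) : term x z.
Arguments Gen {P} tau.
Arguments Id {P} x.
Arguments Zero {P}.

(* The relation is heterogeneous because the two sides of the monoid axioms have
   ends that are only provably equal; by [teq_ends], related terms are parallel. *)
Inductive teq (P : net) :
    forall x y x' y' : pow (place P), term x y -> term x' y' -> Prop :=
| teq_refl x y (f : term x y) : teq f f
| teq_sym x y x' y' (f : term x y) (g : term x' y') : teq f g -> teq g f
| teq_trans x y x' y' x'' y''
    (f : term x y) (g : term x' y') (h : term x'' y'') :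
    teq f g -> teq g h -> teq f h
| teq_Add x1 y1 x2 y2 x1' y1' x2' y2' (f : term x1 y1) (g : term x2 y2)
    (f' : term x1' y1') (g' : term x2' y2') :
    teq f f' -> teq g g' -> teq (Add f g) (Add f' g')
| teq_Comp x y z x' y' z' (g : term y z) (f : term x y)
    (g' : term y' z') (f' : term x' y') :
    teq g g' -> teq f f' -> teq (Comp g f) (Comp g' f')
(* commutative idempotent monoid *)
| teq_AddA x y x' y' x'' y''
    (f : term x y) (g : term x' y') (h : term x'' y'') :
    teq (Add f (Add g h)) (Add (Add f g) h)
| teq_AddC x y x' y' (f : term x y) (g : term x' y') : teq (Add f g) (Add g f)
| teq_Add0 x y (f : term x y) : teq (Add Zero f) f
| teq_Addxx x y (f : term x y) : teq (Add f f) f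
(* category *)
| teq_CompA w x y z (h : term y z) (g : term x y) (f : term w x) :
    teq (Comp h (Comp g f)) (Comp (Comp h g) f)
| teq_Comp1f x y (f : term x y) : teq (Comp (Id y) f) f
| teq_Compf1 x y (f : term x y) : teq (Comp f (Id x)) f
(* composition and identities are monoid homomorphisms *)
| teq_CompD x y z x' y' z' (g : term y z) (f : term x y)
    (g' : term y' z') (f' : term x' y') :
    teq (Comp (Add g g') (Add f f')) (Add (Comp g f) (Comp g' f'))
| teq_Comp0 : teq (Comp Zero Zero) Zero
| teq_IdD x y : teq (Id (pow_add x y)) (Add (Id x) (Id y))
| teq_Id0 : teq (Id (@pow_zero (place P))) Zero.

Lemma teq_ends (P : net) (x y x' y' : pow (place P))
  (f : term x y) (g : term x' y') : teq f g -> x = x' /\ y = y'.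
Proof.
elim=> {x y x' y' f g} //=.
- by move=> *; intuition.
- by move=> x y x' y' x'' y'' f g h _ [-> ->] _ [-> ->].
- by move=> *; intuition; subst.
- by move=> *; intuition.
- by move=> *; rewrite !pow_addA.
- by move=> x y x' y' _ _; rewrite (pow_addC x) (pow_addC y).
- by move=> *; rewrite !pow_add0.
- by move=> *; rewrite !pow_addxx.
Qed.

Record some_term (P : net) := SomeTerm {
  tdom : pow (place P);
  tcod : pow (place P);
  the_term : term tdom tcod
}.
HB.instance Definition _ P := gen_eqMixin (some_term P).
HB.instance Definition _ P := gen_choiceMixin (some_term P).

Definition steq (P : net) (f g : some_term P) : bool :=
  `[< teq (the_term f) (the_term g) >].

Lemma steq_refl (P : net) : reflexive (@steq P).
Proof. by move=> f; apply/asboolP; exact: teq_refl. Qed.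

Lemma steq_sym (P : net) : symmetric (@steq P).
Proof. by move=> f g; apply: asbool_equiv_eq; split; exact: teq_sym. Qed.

Lemma steq_trans (P : net) : transitive (@steq P).
Proof.
move=> g f h /asboolP fg /asboolP gh; apply/asboolP.
exact: teq_trans fg gh.
Qed.

Definition steq_equiv (P : net) : equiv_rel (some_term P) :=
  EquivRel (@steq P) (@steq_refl P) (@steq_sym P) (@steq_trans P).

Definition arrow (P : net) : Type := {eq_quot (steq_equiv P)}.

Definition arrow_of (P : net) (f : some_term P) : arrow P :=
  \pi_({eq_quot (steq_equiv P)}) f.

Definition term_of (P : net) (a : arrow P) : some_term P := repr a.

Definition some_Id (P : net) (x : pow (place P)) : some_term P :=
  SomeTerm (Id x).

Definition some_Add (P : net) (f g : some_term P) : some_term P :=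
  SomeTerm (Add (the_term f) (the_term g)).

Definition some_Comp (P : net) (g f : some_term P) (e : tdom g = tcod f) :
    some_term P :=
  SomeTerm (Comp (the_term g)
    (match esym e in _ = y return term (tdom f) y with
     | erefl => the_term f
     end)).

Lemma term_ofK (P : net) (a : arrow P) : arrow_of (term_of a) = a.
Proof. exact: reprK. Qed.

Lemma arrow_ofP (P : net) (f g : some_term P) :
  arrow_of f = arrow_of g <-> teq (the_term f) (the_term g).
Proof.
split=> [/eqmodP /asboolP //|fg].
by apply/eqmodP/asboolP.
Qed.

Lemma arrow_ofK (P : net) (f : some_term P) :
  teq (the_term (term_of (arrow_of f))) (the_term f).
Proof. by apply/arrow_ofP; rewrite term_ofK. Qed.

Lemma teq_some_Comp (P : net) (g f g' f' : some_term P)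
    (e : tdom g = tcod f) (e' : tdom g' = tcod f') :
  teq (the_term g) (the_term g') -> teq (the_term f) (the_term f') ->
  teq (the_term (some_Comp e)) (the_term (some_Comp e')).
Proof.
case: g f g' f' e e' => [y z g] [x y1 f] [y' z' g'] [x' y1' f'] /= e e'.
by subst=> /= ? ?; exact: teq_Comp.
Qed.

Definition arrow_dom (P : net) (a : arrow P) : pow (place P) := tdom (term_of a).
Definition arrow_cod (P : net) (a : arrow P) : pow (place P) := tcod (term_of a).
Definition arrow_id (P : net) (x : pow (place P)) : arrow P :=
  arrow_of (some_Id x).
Definition arrow_comp (P : net) (b a : arrow P)
    (e : arrow_dom b = arrow_cod a) : arrow P :=
  arrow_of (@some_Comp P (term_of b) (term_of a) e).
Definition arrow_add (P : net) (a b : arrow P) : arrow P :=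
  arrow_of (some_Add (term_of a) (term_of b)).
Definition arrow_zero (P : net) : arrow P := arrow_of (SomeTerm (@Zero P)).
Definition arrow_gen (P : net) (tau : transition P) : arrow P :=
  arrow_of (SomeTerm (Gen tau)).

Lemma arrow_dom_of (P : net) (f : some_term P) : arrow_dom (arrow_of f) = tdom f.
Proof. by case: (teq_ends (arrow_ofK f)). Qed.

Lemma arrow_cod_of (P : net) (f : some_term P) : arrow_cod (arrow_of f) = tcod f.
Proof. by case: (teq_ends (arrow_ofK f)). Qed.

Lemma teq_the_Comp (P : net) (g f : some_term P) (e : tdom g = tcod f)
    (x y z : pow (place P)) (g' : term y z) (f' : term x y) :
  teq (the_term g) g' -> teq (the_term f) f' ->
  teq (the_term (some_Comp e)) (Comp g' f').
Proof.
exact: (@teq_some_Comp P g f (SomeTerm g') (SomeTerm f') e erefl).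
Qed.

Definition free_cat (P : net) : smallcat.
Proof.
refine (@SmallCat (pow (place P)) (arrow P) (@arrow_dom P) (@arrow_cod P)
  (@arrow_id P) (@arrow_comp P) _ _ _ _ _ _ _).
- by move=> x; rewrite arrow_dom_of.
- by move=> x; rewrite arrow_cod_of.
- by move=> g f e; rewrite arrow_dom_of.
- by move=> g f e; rewrite arrow_cod_of.
- move=> f e; rewrite -[RHS]term_ofK; apply/arrow_ofP.
  apply: teq_trans (teq_Comp1f _).
  by apply: teq_the_Comp; [exact: arrow_ofK|exact: teq_refl].
- move=> f e; rewrite -[RHS]term_ofK; apply/arrow_ofP.
  apply: teq_trans (teq_Compf1 _).
  by apply: teq_the_Comp; [exact: teq_refl|exact: arrow_ofK].
- move=> h g f e1 e2 e3 e4; apply/arrow_ofP.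
  apply: (@teq_trans _ _ _ _ _ _ _ _
    (the_term (@some_Comp P (term_of h) (@some_Comp P (term_of g) (term_of f) e1) e3))).
    by apply: teq_some_Comp; [exact: teq_refl|exact: arrow_ofK].
  apply: (@teq_trans _ _ _ _ _ _ _ _
    (the_term (@some_Comp P (@some_Comp P (term_of h) (term_of g) e3) (term_of f) e1))); last first.
    by apply: teq_some_Comp; [apply: teq_sym; exact: arrow_ofK|exact: teq_refl].
  move: e1 e3 {e2 e4}; rewrite /arrow_dom /arrow_cod.
  case: (term_of h) (term_of g) (term_of f) => [? ? h'] [? ? g'] [? ? f'] /=.
  by move=> e1 e3; subst; exact: teq_CompA.
Defined.

Definition free_slat_obj (P : net) : semilattice (pow (place P)) :=
  Semilattice (@pow_addA (place P)) (@pow_addC (place P))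
    (@pow_add0 (place P)) (@pow_addxx (place P)).

Definition free_slat_arr (P : net) : semilattice (arrow P).
Proof.
refine (@Semilattice (arrow P) (@arrow_add P) (@arrow_zero P) _ _ _ _).
- move=> a b c; apply/arrow_ofP.
  apply: (teq_trans (teq_Add (teq_refl _) (arrow_ofK _))).
  apply: (teq_trans (teq_AddA _ _ _)).
  by apply: teq_Add; [apply: teq_sym; exact: arrow_ofK|exact: teq_refl].
- by move=> a b; apply/arrow_ofP; exact: teq_AddC.
- move=> a; rewrite -[RHS]term_ofK; apply/arrow_ofP.
  by apply: teq_trans (teq_Add0 _); apply: teq_Add (arrow_ofK _) (teq_refl _).
- by move=> a; rewrite -[RHS]term_ofK; apply/arrow_ofP; exact: teq_Addxx.
Defined.

Definition free_slatcat (P : net) : slatcat.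
Proof.
refine (@SlatCat (free_cat P) (free_slat_obj P) (free_slat_arr P) _ _ _ _ _).
- by split=> [a b|] /=; rewrite arrow_dom_of.
- by split=> [a b|] /=; rewrite arrow_cod_of.
- split=> [x y|] /=; apply/arrow_ofP => /=; last exact: teq_Id0.
  apply: (teq_trans (teq_IdD _ _)).
  by apply: teq_Add; apply: teq_sym; exact: arrow_ofK.
- move=> g f g' f' e e' e''; apply/arrow_ofP => /=.
  apply: (teq_trans (g := Add (the_term (@some_Comp P (term_of g) (term_of f) e))
                              (the_term (@some_Comp P (term_of g') (term_of f') e'))));
    last by apply: teq_Add; apply: teq_sym; exact: arrow_ofK.
  have e3 : tdom (some_Add (term_of g) (term_of g')) =
            tcod (some_Add (term_of f) (term_of f')).
    exact: (congr2 (@pow_add (place P)) e e').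
  apply: (teq_trans (g := the_term (some_Comp e3))).
    by apply: (@teq_some_Comp P _ _ _ _ e'' e3); exact: arrow_ofK.
  move: e e' e3 {e''}; rewrite /= /arrow_dom /arrow_cod.
  case: (term_of g) (term_of f) (term_of g') (term_of f')
    => [? ? t1] [? ? t2] [? ? t3] [? ? t4] /= e e' e3; subst.
  by rewrite (Prop_irrelevance e3 erefl); exact: teq_CompD.
- move=> e; apply/arrow_ofP; apply: teq_trans (teq_Comp0 _).
  by apply: teq_the_Comp; exact: arrow_ofK.
Defined.

Definition extends (P Q : net) (h : net_hom P Q)
    (H : slatfun (free_slatcat P) (free_slatcat Q)) : Prop :=
  (forall x : pow (place P), on_obj H x = pow_map (on_place h) x) /\
  (forall tau : transition P,
     on_arr H (arrow_gen tau) = arrow_gen (on_transition h tau)).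

(* Main.v *)
Require Import Defs.
From HB Require Import structures.
From mathcomp Require Import all_boot.
From mathcomp Require Import boolp classical_sets cardinality.

Set Implicit Arguments.
Unset Strict Implicit.
Unset Printing Implicit Defensive.

Local Open Scope classical_set_scope.
Local Open Scope cat_scope.

(** The functor [F] is a composite of two left adjoints, through the category
    [SLATCAT] of categories internal to semi-lattices.

    The first one, [free], sends a net to the internal category it generates.
    Its right adjoint [net_of] takes the objects of an internal category [C] as
    places; a transition is an arrow of [C] whose ends are presented as sums of
    finite sets of objects.  The universal property ([free_left_adjoint]) is that
    of a free algebra: the places determine a homomorphism on finite subsets,
    because these form the free semi-lattice ([pow_hom_ext], [pow_sum]), terms are
    then evaluated by recursion, evaluation respects the generating equations
    since they are the axioms of an internal category ([eval_teq]), and two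
    homomorphic functors that agree on generators agree on all terms
    ([free_arr_ext]).

    The second one, [model_of], is the passage from an internal category [C] to
    the product-preserving functor sending [n] to the power of [C] of exponent [n]
    and a tuple of sets of variables to the corresponding tuple of sums.
    Conversely a model [M] makes [M 1%N] an internal category ([internal]): since
    [M n] is isomorphic to the power of [M 1%N], the objects and the arrows of
    [M 1%N] inherit the semi-lattice operations of the theory
    ([slat_set_semilattice]), and these are compatible with domains, identities
    and composition because they are induced by functors.  A natural
    transformation between models is determined by its component at [1%N], which
    can be any homomorphic functor ([model_of_left_adjoint]).

    The comparison of the generated category with the value of the model at [1%N]
    is the isomorphism of a category with its first power, and the action of [F]
    on morphisms of nets is computed by [free_map]. *)

(** * Adjunctions from universal arrows *)

Definition functor_comp (C D E : category) (G : functor D E) (F : functor C D) :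
  functor C E.
Proof.
refine (@Functor C E (fun x => G (F x)) (fun x y f => fmap G (fmap F f)) _ _).
- by move=> x; rewrite !fmap_id.
- by move=> x y z g f; rewrite !fmap_comp.
Defined.

Lemma is_left_adjoint_comp (C D E : category) (G : functor D E)
    (F : functor C D) :
  is_left_adjoint F -> is_left_adjoint G -> is_left_adjoint (functor_comp G F).
Proof.
move=> [U [a]] [V [b]]; exists (functor_comp U V); constructor.
refine (@Adjunction C E (functor_comp G F) (functor_comp U V)
  (fun x y f => adj_r a (adj_r b f)) (fun x y f => adj_l b (adj_l a f)) _ _ _).
- by move=> x y f /=; rewrite (adj_rK a) (adj_rK b).
- by move=> x y f /=; rewrite (adj_lK b) (adj_lK a).
- by move=> x x' y y' h f k /=; rewrite (adj_nat b) (adj_nat a).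
Qed.

(** A natural family of universal arrows makes [F] left adjoint to [U]: the
    transpose of [f] is [U f] precomposed with the universal arrow, and its
    inverse is chosen from the unique factorizations. *)
Lemma left_adjoint_of_universal (C D : category) (F : functor C D)
    (U : functor D C) (eta : forall x : C, hom x (U (F x))) :
  (forall x y (h : hom x y), eta y \oc h = fmap U (fmap F h) \oc eta x) ->
  (forall x (y : D) (k : hom x (U y)),
     exists! f : hom (F x) y, fmap U f \oc eta x = k) ->
  is_left_adjoint F.
Proof.
move=> eta_nat univ; exists U; constructor.
refine (@Adjunction C D F U (fun x y f => fmap U f \oc eta x)
  (fun x y k => sval (cid (univ x y k))) _ _ _).
- by move=> x y f; case: cid => g /= [_]; apply.
- by move=> x y k; case: cid => g /= [].
- by move=> x x' y y' h f k; rewrite !fmap_comp -!compmA eta_nat.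
Qed.

(** * Joins in semi-lattices *)

HB.instance Definition _ (T : Type) (S : semilattice T) :=
  Monoid.isComLaw.Build T (szero S) (sadd S) (@saddA T S) (@saddC T S)
    (@sadd0 T S).

Definition sle (T : Type) (S : semilattice T) (x y : T) : Prop :=
  sadd S x y = y.

Section Order.
Variables (T : Type) (S : semilattice T).
Local Notation "x <= y" := (sle S x y).

Lemma sle_refl x : x <= x. Proof. exact: saddxx. Qed.

Lemma sle_anti x y : x <= y -> y <= x -> x = y.
Proof. by rewrite /sle => xy yx; rewrite -xy -{1}yx saddC. Qed.

Lemma sle0 x : szero S <= x. Proof. exact: sadd0. Qed.

Lemma sle_add x y u : sadd S x y <= u <-> x <= u /\ y <= u.
Proof.
rewrite /sle; split=> [<-|[xu yu]]; last by rewrite -saddA yu xu.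
split; first by rewrite !saddA saddxx.
by rewrite (saddC S x y) !saddA saddxx.
Qed.

Lemma sle_eq x y : (forall u, x <= u <-> y <= u) -> x = y.
Proof. by move=> xy; apply: sle_anti; apply/xy; exact: sle_refl. Qed.

Lemma big_sle (I : finType) (A : {set I}) (x : I -> T) u :
  \big[sadd S/szero S]_(i in A) x i <= u <-> forall i, i \in A -> x i <= u.
Proof.
split=> [+ i iA|xu].
  by rewrite (bigD1 i) //= => /sle_add[].
by elim/big_ind: _ => // [|y z yu zu]; [exact: sle0|exact/sle_add].
Qed.

(** A union may cover an index several times, so that this is where idempotency
    is used: both sides are the least upper bound of the same elements. *)
Lemma big_bigcup (I J : finType) (A : {set J}) (B : J -> {set I}) (x : I -> T) :
  \big[sadd S/szero S]_(i in (\bigcup_(j in A) B j)%SET) x i =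
  \big[sadd S/szero S]_(j in A) \big[sadd S/szero S]_(i in B j) x i.
Proof.
apply: sle_eq => u; rewrite !big_sle; split=> xu.
  by move=> j jA; apply/big_sle => i iB; apply: xu; apply/finset.bigcupP; exists j.
move=> i /finset.bigcupP[j jA iB].
by have /big_sle := xu j jA; apply.
Qed.

End Order.

Lemma semilattice_hom_comp (T U V : Type) (a : semilattice T)
    (b : semilattice U) (c : semilattice V) (g : U -> V) (f : T -> U) :
  semilattice_hom b c g -> semilattice_hom a b f ->
  semilattice_hom a c (g \o f).
Proof. by move=> [gD g0] [fD f0]; split=> [x y|] /=; rewrite ?fD ?f0. Qed.

Lemma semilattice_hom_big (T U : Type) (a : semilattice T) (b : semilattice U)
    (f : T -> U) (I : finType) (A : {set I}) (x : I -> T) :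
  semilattice_hom a b f ->
  f (\big[sadd a/szero a]_(i in A) x i) = \big[sadd b/szero b]_(i in A) f (x i).
Proof. by move=> [fD f0]; exact: (big_morph f fD f0). Qed.

(** * Finite subsets as the free semi-lattice *)

Definition pow_slat (X : Type) : semilattice (pow X) :=
  Semilattice (@pow_addA X) (@pow_addC X) (@pow_add0 X) (@pow_addxx X).

Lemma pow_ind (X : Type) (K : pow X -> Prop) :
  K (@pow_zero X) -> (forall x, K (pow_unit x)) ->
  (forall A B, K A -> K B -> K (pow_add A B)) -> forall A, K A.
Proof.
move=> K0 K1 KD [A finA].
have [s As] : exists s : seq {classic X}, A = [set` s] by exact/finite_seqP.
elim: s A finA As => [|x s IH] A finA As.
  suff -> : exist _ A finA = @pow_zero X by [].
  by apply: pow_eq => /=; rewrite As set_nil.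
have fins : finite_set ([set` s] : set X).
  by apply/(@finite_seqP {classic X}); exists s.
suff -> : exist _ A finA = pow_add (pow_unit x) (exist _ _ fins).
  by apply: KD => //; exact: IH.
apply: pow_eq; rewrite /= As; apply/seteqP; split=> y /=; rewrite in_cons.
  by case/orP=> [/eqP ->|ys]; [left|right].
by case=> [->|->]; rewrite ?eqxx ?orbT.
Qed.

Lemma pow_map_unit (X Y : Type) (g : X -> Y) (x : X) :
  pow_map g (pow_unit x) = pow_unit (g x).
Proof. by apply: pow_eq; exact: image_set1. Qed.

Lemma pow_map_hom (X Y : Type) (g : X -> Y) :
  semilattice_hom (pow_slat X) (pow_slat Y) (pow_map g).
Proof.
by split=> [A B|]; apply: pow_eq => /=; [exact: image_setU|exact: image_set0].
Qed.

Lemma pow_hom_ext (X T : Type) (S : semilattice T) (f g : pow X -> T) :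
  semilattice_hom (pow_slat X) S f -> semilattice_hom (pow_slat X) S g ->
  (forall x, f (pow_unit x) = g (pow_unit x)) -> f =1 g.
Proof.
move=> [fD f0] [gD g0] fg; elim/pow_ind => [|x|A B fA fB].
- exact: etrans f0 (esym g0).
- exact: fg.
- by have /= -> := fD A B; have /= -> := gD A B; rewrite fA fB.
Qed.

Section FiniteSum.
Variables (T : Type) (S : semilattice T).

Lemma pow_lub (A : pow T) :
  exists z, forall u, sle S z u <-> forall x, sval A x -> sle S x u.
Proof.
elim/pow_ind: A => [|x|A B [a aP] [b bP]].
- by exists (szero S) => u; split=> // _; exact: sle0.
- by exists x => u; split=> [xu _ -> //|]; apply.
- exists (sadd S a b) => u; rewrite sle_add aP bP; split.
    by move=> [Au Bu] x [/Au|/Bu].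
  by move=> ABu; split=> x xA; apply: ABu; [left|right].
Qed.

(** The sum of a finite subset, taken as its least upper bound: this avoids
    enumerating the subset and makes the sum well defined at once. *)
Definition pow_sum (A : pow T) : T := sval (cid (pow_lub A)).

Lemma pow_sumP (A : pow T) u :
  sle S (pow_sum A) u <-> forall x, sval A x -> sle S x u.
Proof. exact: (svalP (cid (pow_lub A))). Qed.

Lemma pow_sum_unit x : pow_sum (pow_unit x) = x.
Proof.
apply: (@sle_eq _ S) => u; rewrite pow_sumP.
by split=> [|xu _ -> //]; apply.
Qed.

Lemma pow_sum_hom : semilattice_hom (pow_slat T) S pow_sum.
Proof.
split=> [A B|]; apply: (@sle_eq _ S) => u.
  rewrite sle_add !pow_sumP; split=> [ABu|[Au Bu] x [/Au|/Bu] //].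
  by split=> x xA; apply: ABu; [left|right].
by rewrite pow_sumP; split=> // _; exact: sle0.
Qed.

End FiniteSum.

Lemma pow_sum_map (T U : Type) (a : semilattice T) (b : semilattice U)
    (f : T -> U) (A : pow T) :
  semilattice_hom a b f -> f (pow_sum a A) = pow_sum b (pow_map f A).
Proof.
move=> fH; apply: (@pow_hom_ext _ _ b (f \o pow_sum a)
  (pow_sum b \o pow_map f)) A => [||x] /=.
- exact: semilattice_hom_comp fH (pow_sum_hom a).
- exact: semilattice_hom_comp (pow_sum_hom b) (pow_map_hom f).
- by rewrite pow_map_unit !pow_sum_unit.
Qed.

(** This is what makes a generating arrow a transition of the underlying net, its
    ends being presented as sums of singletons. *)
Lemma pow_sum_map_unit (X : Type) (A : pow X) :
  pow_sum (pow_slat X) (pow_map (@pow_unit X) A) = A.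
Proof.
apply: (@pow_hom_ext _ _ (pow_slat X)
  (pow_sum (pow_slat X) \o pow_map (@pow_unit X)) id) A => [||x] /=.
- exact: semilattice_hom_comp (pow_sum_hom _) (pow_map_hom _).
- by [].
- by rewrite pow_map_unit pow_sum_unit.
Qed.

(** * The category of internal categories *)

Lemma slatfun_eq (C D : slatcat) (H K : slatfun C D) :
  on_obj H =1 on_obj K -> on_arr H =1 on_arr K -> H = K.
Proof.
case: H K => [H ? ?] [K ? ?] /= eo ea.
have ? : H = K by exact: catfun_eq.
by subst; f_equal; exact: Prop_irrelevance.
Qed.

Definition slatfun_id (C : slatcat) : slatfun C C.
Proof. by refine (@SlatFun C C (catfun_id C) _ _). Defined.

Definition slatfun_comp (C D E : slatcat) (K : slatfun D E) (H : slatfun C D) :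
  slatfun C E.
Proof.
refine (@SlatFun C E (catfun_comp K H) _ _).
- exact: semilattice_hom_comp (on_obj_slat K) (on_obj_slat H).
- exact: semilattice_hom_comp (on_arr_slat K) (on_arr_slat H).
Defined.

Definition SLATCAT : category.
Proof.
by refine (@Category slatcat slatfun slatfun_id slatfun_comp _ _ _) => *;
   exact: slatfun_eq.
Defined.

(** * The universal property of the generated category *)

(** Composition totalized with a junk value, so that terms can be evaluated by
    plain recursion, before their ends are known to match. *)
Definition pcomp (C : smallcat) (g f : arr C) : arr C :=
  match pselect (dom g = cod f) with
  | left e => compose g f e
  | right _ => g
  end.

Lemma pcompE (C : smallcat) (g f : arr C) (e : dom g = cod f) :
  pcomp g f = compose g f e.
Proof.
by rewrite /pcomp; case: pselect => // e'; congr compose; exact: Prop_irrelevance.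
Qed.

Lemma pcomp1f (C : smallcat) (f : arr C) : pcomp (ident (cod f)) f = f.
Proof. by rewrite (pcompE (dom_ident (cod f))); exact: compose1f. Qed.

Section Lift.
Variables (P : net) (D : slatcat) (o : pow (place P) -> obj D).
Hypothesis oH : semilattice_hom (pow_slat (place P)) (slat_obj D) o.
Variable t : transition P -> arr D.
Hypothesis dom_t : forall tau, dom (t tau) = o (source tau).
Hypothesis cod_t : forall tau, cod (t tau) = o (target tau).

Fixpoint eval_term x y (f : term x y) : arr D :=
  match f with
  | Gen tau => t tau
  | Id x => ident (o x)
  | Zero => szero (slat_arr D)
  | Add _ _ _ _ f g => sadd (slat_arr D) (eval_term f) (eval_term g)
  | Comp _ _ _ g f => pcomp (eval_term g) (eval_term f)
  end.

Lemma eval_ends x y (f : term x y) :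
  dom (eval_term f) = o x /\ cod (eval_term f) = o y.
Proof.
have [oD o0] := oH; have [dD d0] := dom_slat D; have [cD c0] := cod_slat D.
elim: f => {x y} /= [tau|x||x y x' y' f [df cf] g [dg cg]|x y z g [dg cg] f [df cf]].
- by rewrite dom_t cod_t.
- by rewrite dom_ident cod_ident.
- by rewrite d0 c0 -o0.
- by rewrite dD cD df cf dg cg -!oD.
- have e : dom (eval_term g) = cod (eval_term f) by rewrite dg cf.
  by rewrite (pcompE e) dom_compose cod_compose.
Qed.

Lemma eval_composable x y z (g : term y z) (f : term x y) :
  dom (eval_term g) = cod (eval_term f).
Proof. by rewrite (proj1 (eval_ends g)) (proj2 (eval_ends f)). Qed.

Lemma eval_teq x y x' y' (f : term x y) (g : term x' y') :
  teq f g -> eval_term f = eval_term g.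
Proof.
have [oD o0] := oH; have [iD i0] := ident_slat D.
elim=> {x y x' y' f g} //=.
- by move=> *; congruence.
- by move=> x1 y1 x2 y2 x3 y3 x4 y4 f g f' g' _ -> _ ->.
- by move=> x y z x' y' z' g f g' f' _ -> _ ->.
- by move=> *; exact: saddA.
- by move=> *; exact: saddC.
- by move=> *; exact: sadd0.
- by move=> *; exact: saddxx.
- move=> w x y z h g f.
  have hg := eval_composable h g; have gf := eval_composable g f.
  have h_gf := eval_composable h (Comp g f).
  have hg_f := eval_composable (Comp h g) f.
  move: h_gf hg_f; rewrite /= (pcompE hg) (pcompE gf) => h_gf hg_f.
  by rewrite (pcompE h_gf) (pcompE hg_f); exact: composeA.
- move=> x y f; have e := eval_composable (Id y) f.
  have := e; rewrite /= -(proj2 (eval_ends f)) => e'.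
  by rewrite (pcompE e'); exact: compose1f.
- move=> x y f; have e := eval_composable f (Id x).
  have := e; rewrite /= -(proj1 (eval_ends f)) => e'.
  by rewrite (pcompE e'); exact: composef1.
- move=> x y z x' y' z' g f g' f'.
  rewrite (pcompE (eval_composable g f)) (pcompE (eval_composable g' f')).
  rewrite (pcompE (eval_composable (Add g g') (Add f f'))).
  exact: compose_sadd.
- by rewrite (pcompE (eval_composable Zero Zero)); exact: compose_szero.
- by move=> x y; rewrite -iD -oD.
- by rewrite -i0 -o0.
Qed.

Lemma eval_of (f : some_term P) :
  eval_term (the_term (term_of (arrow_of f))) = eval_term (the_term f).
Proof. exact/eval_teq/arrow_ofK. Qed.

Definition lift_fun : catfun (free_cat P) D.
Proof.
refine (@CatFun (free_cat P) D o
  (fun a => eval_term (the_term (term_of a))) _ _ _ _).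
- by move=> a; exact: (proj1 (eval_ends _)).
- by move=> a; exact: (proj2 (eval_ends _)).
- by move=> x; exact: eval_of.
- move=> g f e e' /=; rewrite /arrow_comp eval_of.
  move: e e'; rewrite /= /arrow_dom /arrow_cod.
  case: (term_of g) (term_of f) => [y z g'] [x y' f'] /= e; subst => e' /=.
  exact: pcompE.
Defined.

Definition lift : slatfun (free_slatcat P) D.
Proof.
by refine (@SlatFun (free_slatcat P) D lift_fun oH _);
   split=> [a b|]; exact: eval_of.
Defined.

Lemma lift_gen tau : on_arr lift (arrow_gen tau) = t tau.
Proof. exact: eval_of. Qed.

End Lift.

(** Arrows are classes of terms, so that an induction on terms reduces the
    equality of two homomorphic functors to the generators. *)
Lemma free_arr_ext (P : net) (D : slatcat) (H K : slatfun (free_slatcat P) D) :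
  on_obj H =1 on_obj K ->
  (forall tau, on_arr H (arrow_gen tau) = on_arr K (arrow_gen tau)) -> H = K.
Proof.
move=> eo eg; apply: slatfun_eq => // a; rewrite -(term_ofK a).
have [HD H0] := on_arr_slat H; have [KD K0] := on_arr_slat K.
case: (term_of a) => x y f {a}.
elim: f => {x y} [tau|x||x y x' y' f IHf g IHg|x y z g IHg f IHf].
- exact: eg.
- have /= HI := on_arr_ident H x; have /= KI := on_arr_ident K x.
  by rewrite HI KI eo.
- exact: etrans H0 (esym K0).
- have -> : arrow_of (SomeTerm (Add f g)) =
      arrow_add (arrow_of (SomeTerm f)) (arrow_of (SomeTerm g)).
    by apply/arrow_ofP; apply: teq_Add; apply: teq_sym; exact: arrow_ofK.
  by have /= -> := HD; have /= -> := KD; congr sadd.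
- have e : arrow_dom (arrow_of (SomeTerm g)) = arrow_cod (arrow_of (SomeTerm f)).
    by rewrite arrow_dom_of arrow_cod_of.
  have -> : arrow_of (SomeTerm (Comp g f)) = arrow_comp e.
    by apply/arrow_ofP; apply: teq_sym; apply: teq_the_Comp; exact: arrow_ofK.
  have He : dom (on_arr H (arrow_of (SomeTerm g))) =
            cod (on_arr H (arrow_of (SomeTerm f))).
    by rewrite dom_on_arr cod_on_arr; congr on_obj.
  have Ke : dom (on_arr K (arrow_of (SomeTerm g))) =
            cod (on_arr K (arrow_of (SomeTerm f))).
    by rewrite dom_on_arr cod_on_arr; congr on_obj.
  have /= -> := on_arr_compose (c := H) e He.
  have /= -> := on_arr_compose (c := K) e Ke.
  by rewrite -(pcompE He) -(pcompE Ke); congr pcomp.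
Qed.

Section FreeMap.
Variables (P Q : net) (h : net_hom P Q).

Let gen_dom tau :
  arrow_dom (arrow_gen (on_transition h tau)) = pow_map (on_place h) (source tau).
Proof. by rewrite arrow_dom_of /= source_hom. Qed.

Let gen_cod tau :
  arrow_cod (arrow_gen (on_transition h tau)) = pow_map (on_place h) (target tau).
Proof. by rewrite arrow_cod_of /= target_hom. Qed.

Definition free_map : slatfun (free_slatcat P) (free_slatcat Q) :=
  @lift P (free_slatcat Q) _ (pow_map_hom (on_place h)) _ gen_dom gen_cod.

Lemma free_map_extends : extends h free_map.
Proof. by split=> [//|tau]; exact: lift_gen. Qed.

Lemma free_map_unique (H : slatfun (free_slatcat P) (free_slatcat Q)) :
  extends h H -> H = free_map.
Proof.
have [Fo Fa] := free_map_extends; move=> [Ho Ha].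
by apply: free_arr_ext => [x|tau]; rewrite ?Ho ?Ha ?Fo ?Fa.
Qed.

End FreeMap.

Definition free : functor SLATNet SLATCAT.
Proof.
refine (@Functor SLATNet SLATCAT free_slatcat free_map _ _).
- move=> P; apply/esym/free_map_unique; split=> [x|tau] //=.
  by rewrite pow_map_id.
- move=> P Q K k h; apply/esym/free_map_unique; split=> [x|tau] /=.
    by rewrite pow_map_comp.
  exact: etrans (congr1 (on_arr (free_map k)) (proj2 (free_map_extends h) tau))
    (proj2 (free_map_extends k) _).
Defined.

(** * The net underlying an internal category *)

(** A transition is an arrow together with a way of writing its ends as sums of
    finite sets of objects: a net has sets of places, and not their sums, as
    sources and targets. *)
Record net_transition (C : slatcat) := NetTransition {
  nt_source : pow (obj C);
  nt_target : pow (obj C);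
  nt_arr : arr C;
  nt_dom : dom nt_arr = pow_sum (slat_obj C) nt_source;
  nt_cod : cod nt_arr = pow_sum (slat_obj C) nt_target
}.

Lemma net_transition_eq (C : slatcat) (a b : net_transition C) :
  nt_source a = nt_source b -> nt_target a = nt_target b ->
  nt_arr a = nt_arr b -> a = b.
Proof.
case: a b => [x y f ? ?] [x' y' f' ? ?] /= ? ? ?; subst.
by f_equal; exact: Prop_irrelevance.
Qed.

Definition underlying_net (C : slatcat) : net :=
  Net (@nt_source C) (@nt_target C).

Definition transition_map (C D : slatcat) (H : slatfun C D)
    (a : net_transition C) : net_transition D.
Proof.
refine (@NetTransition D (pow_map (on_obj H) (nt_source a))
  (pow_map (on_obj H) (nt_target a)) (on_arr H (nt_arr a)) _ _).
- by rewrite dom_on_arr nt_dom; exact: pow_sum_map (on_obj_slat H).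
- by rewrite cod_on_arr nt_cod; exact: pow_sum_map (on_obj_slat H).
Defined.

Definition underlying_net_map (C D : slatcat) (H : slatfun C D) :
  net_hom (underlying_net C) (underlying_net D).
Proof.
by refine (@NetHom (underlying_net C) (underlying_net D) (transition_map H)
  (on_obj H) _ _).
Defined.

Definition net_of : functor SLATCAT SLATNet.
Proof.
refine (@Functor SLATCAT SLATNet underlying_net underlying_net_map _ _).
- move=> C; apply: net_hom_eq => //= a.
  by apply: net_transition_eq => //=; exact: pow_map_id.
- move=> C D E K H; apply: net_hom_eq => //= a.
  by apply: net_transition_eq => //=; exact: pow_map_comp.
Defined.

Definition free_transition (P : net) (tau : transition P) :
  net_transition (free_slatcat P).
Proof.
refine (@NetTransition (free_slatcat P) (pow_map (@pow_unit _) (source tau))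
  (pow_map (@pow_unit _) (target tau)) (arrow_gen tau) _ _).
- by rewrite [RHS]pow_sum_map_unit /= arrow_dom_of.
- by rewrite [RHS]pow_sum_map_unit /= arrow_cod_of.
Defined.

Definition free_unit (P : net) : net_hom P (underlying_net (free_slatcat P)).
Proof.
by refine (@NetHom P (underlying_net (free_slatcat P)) (@free_transition P)
  (@pow_unit _) _ _).
Defined.

Lemma free_left_adjoint : is_left_adjoint free.
Proof.
apply: (@left_adjoint_of_universal SLATNet SLATCAT free net_of free_unit).
  move=> P Q h; apply: net_hom_eq => [tau|s] /=; last by rewrite pow_map_unit.
  apply: net_transition_eq => /=.
  - rewrite source_hom -!pow_map_comp; congr (pow_map _ _).
    by apply: funext => s /=; rewrite pow_map_unit.
  - rewrite target_hom -!pow_map_comp; congr (pow_map _ _).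
    by apply: funext => s /=; rewrite pow_map_unit.
  - exact: esym (proj2 (free_map_extends h) tau).
move=> P D k.
pose o A := pow_sum (slat_obj D) (pow_map (on_place k) A).
have oH : semilattice_hom (pow_slat (place P)) (slat_obj D) o.
  exact: semilattice_hom_comp (pow_sum_hom _) (pow_map_hom _).
pose t tau := nt_arr (on_transition k tau).
have dom_t tau : dom (t tau) = o (source tau).
  by rewrite /t nt_dom; have /= -> := source_hom k tau.
have cod_t tau : cod (t tau) = o (target tau).
  by rewrite /t nt_cod; have /= -> := target_hom k tau.
have lift_place s : o (pow_unit s) = on_place k s.
  by rewrite /o pow_map_unit pow_sum_unit.
exists (lift oH dom_t cod_t); split.
  apply: net_hom_eq => [tau|s] /=; last exact: lift_place.
  apply: net_transition_eq => /=; last exact: lift_gen.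
  - rewrite -pow_map_comp; have /= -> := source_hom k tau.
    by congr (pow_map _ _); apply: funext.
  - rewrite -pow_map_comp; have /= -> := target_hom k tau.
    by congr (pow_map _ _); apply: funext.
move=> H Hk; apply: free_arr_ext => [A|tau].
  apply: (@pow_hom_ext _ _ (slat_obj D) o (on_obj H)) => //.
    exact: on_obj_slat H.
  by move=> s; rewrite lift_place -Hk.
by rewrite lift_gen /t -Hk.
Qed.

(** * Powers of a category *)

Definition power_cat (C : smallcat) (n : nat) : smallcat.
Proof.
refine (@SmallCat ('I_n -> obj C) ('I_n -> arr C) (fun f i => dom (f i))
  (fun f i => cod (f i)) (fun x i => ident (x i))
  (fun g f e i => compose (g i) (f i) (congr1 (@^~ i) e)) _ _ _ _ _ _ _).
- by move=> x; apply: funext => i; exact: dom_ident.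
- by move=> x; apply: funext => i; exact: cod_ident.
- by move=> g f e; apply: funext => i; exact: dom_compose.
- by move=> g f e; apply: funext => i; exact: cod_compose.
- by move=> f e; apply: funext => i; exact: compose1f.
- by move=> f e; apply: funext => i; exact: composef1.
- by move=> h g f e1 e2 e3 e4; apply: funext => i; exact: composeA.
Defined.

Definition power_proj (C : smallcat) (n : nat) (i : 'I_n) :
  catfun (power_cat C n) C.
Proof.
refine (@CatFun (power_cat C n) C (@^~ i) (@^~ i) _ _ _ _) => //.
by move=> g f e e'; congr compose; exact: Prop_irrelevance.
Defined.

Definition power_tuple (C Y : smallcat) (n : nat) (f : 'I_n -> catfun Y C) :
  catfun Y (power_cat C n).
Proof.
refine (@CatFun Y (power_cat C n) (fun y i => on_obj (f i) y)
  (fun a i => on_arr (f i) a) _ _ _ _).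
- by move=> a; apply: funext => i; exact: dom_on_arr.
- by move=> a; apply: funext => i; exact: cod_on_arr.
- by move=> y; apply: funext => i; exact: on_arr_ident.
- by move=> g h e e'; apply: funext => i; exact: on_arr_compose.
Defined.

Definition power_map (C D : smallcat) (H : catfun C D) (n : nat) :
    catfun (power_cat C n) (power_cat D n) :=
  power_tuple (fun i => catfun_comp H (@power_proj C n i)).

Lemma catfun_eqE (C D : smallcat) (F G : catfun C D) :
  F = G -> on_obj F =1 on_obj G /\ on_arr F =1 on_arr G.
Proof. by move=> ->. Qed.

(** * Products in the theory *)

Lemma slat_proj_is_product (n : nat) :
  @is_product SLAT n (fun=> 1%N) n (@slat_proj n).
Proof.
move=> y f; exists (fun i => f i ord0); split=> [i|h hf].
  by apply: funext => j; rewrite (ord1 j) /= finset.big_set1.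
by apply: funext => i; rewrite -hf /= finset.big_set1.
Qed.

(** The sum of the [x i], with one generator for each generator of a factor. *)
Definition sum_arity (n : nat) (x : 'I_n -> nat) : nat :=
  #|{: {i : 'I_n & 'I_(x i)}}|.

Definition sum_proj (n : nat) (x : 'I_n -> nat) (i : 'I_n) :
    @hom SLAT (sum_arity x) (x i) :=
  fun k => [set enum_rank (Tagged (fun i => 'I_(x i)) k)]%SET.

(** Any product diagram is a retract of the one on [sum_arity x], through maps
    that commute with the projections, so that only the latter is needed. *)
Lemma preserves_sum_proj (D : category) (F : functor SLAT D) :
  (forall n (x : 'I_n -> nat),
     @is_product D n (fun i => F (x i)) (F (sum_arity x))
       (fun i => fmap F (sum_proj (i := i)))) ->
  preserves_products F.
Proof.
move=> FP n x p pi piP.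
pose N := sum_arity x.
have [u [uP _]] := piP N (fun i => sum_proj (i := i)).
pose v : @hom SLAT p N := fun r => pi (tag (enum_val r)) (tagged (enum_val r)).
have vP i : sum_proj (i := i) \oc v = pi i.
  by apply: funext => k; rewrite /= finset.big_set1 /v enum_rankK.
have uv : u \oc v = idm p.
  have [w [_ wU]] := piP p pi.
  rewrite -(wU (u \oc v)) => [|i]; last by rewrite compmA uP vP.
  by apply: wU => i; rewrite compm1.
move=> Y f; have [k [kP kU]] := FP n x Y f.
exists (fmap F u \oc k); split=> [i|h hf].
  by rewrite compmA -fmap_comp uP.
rewrite (kU (fmap F v \oc h)) => [|i]; last by rewrite compmA -fmap_comp vP.
by rewrite compmA -fmap_comp uv fmap_id comp1m.
Qed.

(** * From internal categories to models *)

Section ModelOf.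
Variable C : slatcat.
Local Notation "\osum_ ( i 'in' A ) x" :=
  (\big[sadd (slat_obj C)/szero (slat_obj C)]_(i in A) x)
  (at level 41, i, A at level 50).
Local Notation "\asum_ ( i 'in' A ) x" :=
  (\big[sadd (slat_arr C)/szero (slat_arr C)]_(i in A) x)
  (at level 41, i, A at level 50).

(** Composition is a homomorphism on composable pairs only; the induction
    therefore carries along the composability of the partial sums. *)
Lemma compose_big (I : finType) (A : {set I}) (g f : I -> arr C)
    (e : forall i, dom (g i) = cod (f i))
    (e' : dom (\asum_(i in A) g i) = cod (\asum_(i in A) f i)) :
  \asum_(i in A) compose (g i) (f i) (e i) = compose _ _ e'.
Proof.
suff [e'' ->] : exists e'' : dom (\asum_(i in A) g i) = cod (\asum_(i in A) f i),
    \asum_(i in A) compose (g i) (f i) (e i) = compose _ _ e''.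
  by congr compose; exact: Prop_irrelevance.
have [dD d0] := dom_slat C; have [cD c0] := cod_slat C.
apply: (big_ind3 (fun a b c => exists e'' : dom b = cod c, a = compose b c e'')).
- have e0 : dom (szero (slat_arr C)) = cod (szero (slat_arr C)).
    by rewrite d0 c0.
  by exists e0; rewrite (compose_szero e0).
- move=> a1 b1 c1 a2 b2 c2 [e1 ->] [e2 ->].
  have e12 : dom (sadd (slat_arr C) b1 b2) = cod (sadd (slat_arr C) c1 c2).
    by rewrite dD cD e1 e2.
  by exists e12; rewrite (compose_sadd e1 e2 e12).
- by move=> i _; exists (e i).
Qed.

Definition power_op (n m : nat) (f : @hom SLAT n m) :
  catfun (power_cat C n) (power_cat C m).
Proof.
refine (@CatFun (power_cat C n) (power_cat C m)
  (fun x i => \osum_(j in f i) x j) (fun a i => \asum_(j in f i) a j) _ _ _ _).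
- by move=> a; apply: funext => i; exact: semilattice_hom_big (dom_slat C).
- by move=> a; apply: funext => i; exact: semilattice_hom_big (cod_slat C).
- move=> x; apply: funext => i; apply: esym.
  exact: semilattice_hom_big (ident_slat C).
- by move=> g h e e'; apply: funext => i; exact: compose_big.
Defined.

Definition model_functor : functor SLAT CAT.
Proof.
refine (@Functor SLAT CAT (power_cat C) power_op _ _).
- by move=> n; apply: catfun_eq => [x|a]; apply: funext => i;
     exact: finset.big_set1.
- by move=> n m k g f; apply: catfun_eq => [x|a]; apply: funext => i;
     exact: big_bigcup.
Defined.

Lemma model_functor_prod : preserves_products model_functor.
Proof.
apply: preserves_sum_proj => n x Y f.
pose R := {i : 'I_n & 'I_(x i)}.
pose part (r : 'I_(sum_arity x)) : R := enum_val r.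
exists (power_tuple (fun r => catfun_comp (@power_proj C _ (tagged (part r)))
  (f (tag (part r))))); split=> [i|H Hf].
  by apply: catfun_eq => [y|a]; apply: funext => k;
     rewrite /= finset.big_set1 /part enum_rankK.
have rankK r : enum_rank (Tagged (fun i => 'I_(x i)) (tagged (part r))) = r.
  by rewrite -[RHS]enum_valK; congr enum_rank; rewrite /part; case: enum_val.
have [Ho Ha] := (fun r => proj1 (catfun_eqE (Hf (tag (part r)))),
                 fun r => proj2 (catfun_eqE (Hf (tag (part r))))).
apply: catfun_eq => [y|a]; apply: funext => r.
- have := congr1 (@^~ (tagged (part r))) (Ho r y).
  by rewrite /= finset.big_set1 rankK.
- have := congr1 (@^~ (tagged (part r))) (Ha r a).
  by rewrite /= finset.big_set1 rankK.
Qed.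

Definition model_of_slatcat : model CAT := Model model_functor_prod.

End ModelOf.

Definition model_map (C D : slatcat) (H : slatfun C D) :
  nattrans (model_of_slatcat C) (model_of_slatcat D).
Proof.
refine (@NatTrans SLAT CAT (model_of_slatcat C) (model_of_slatcat D)
  (power_map H) _).
move=> n m f; apply: catfun_eq => [x|a]; apply: funext => i.
- exact: semilattice_hom_big (on_obj_slat H).
- exact: semilattice_hom_big (on_arr_slat H).
Defined.

Definition model_of : functor SLATCAT (Mod CAT).
Proof.
refine (@Functor SLATCAT (Mod CAT) model_of_slatcat model_map _ _).
- by move=> C; apply: nattrans_eq => n; exact: catfun_eq.
- by move=> C D E K H; apply: nattrans_eq => n; exact: catfun_eq.
Defined.

(** * Set-valued models as semi-lattices *)

(** Preservation of the finite powers of [1%N], the generic object of the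
    theory, in the elementary form of a bijection with tuples. *)
Definition slat_set (G : functor SLAT SET) : Prop :=
  forall n (x : 'I_n -> G 1%N),
    exists! w : G n, forall i, fmap G (slat_proj i) w = x i.

Section SlatSet.
Variables (G : functor SLAT SET) (GP : slat_set G).

Definition slat_tuple n (x : 'I_n -> G 1%N) : G n := sval (cid (GP x)).

Lemma slat_tupleP n (x : 'I_n -> G 1%N) i :
  fmap G (slat_proj i) (slat_tuple x) = x i.
Proof. by rewrite /slat_tuple; case: cid => w /= []. Qed.

Lemma slat_tuple_unique n (x : 'I_n -> G 1%N) w :
  (forall i, fmap G (slat_proj i) w = x i) -> slat_tuple x = w.
Proof. by rewrite /slat_tuple; case: cid => v /= [_]; apply. Qed.

Definition slat_op n (A : {set 'I_n}) (x : 'I_n -> G 1%N) : G 1%N :=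
  fmap G ((fun=> A) : @hom SLAT n 1%N) (slat_tuple x).

Lemma slat_op1 n i (x : 'I_n -> G 1%N) : slat_op [set i]%SET x = x i.
Proof. exact: slat_tupleP. Qed.

(** Functoriality of [G] on the composite of the tuple [B] with [A]. *)
Lemma slat_op_bigcup n m (A : {set 'I_m}) (B : 'I_m -> {set 'I_n}) x :
  slat_op (\bigcup_(j in A) B j)%SET x = slat_op A (fun j => slat_op (B j) x).
Proof.
rewrite [RHS]/slat_op.
have -> : slat_tuple (fun j => slat_op (B j) x) =
    fmap G (B : @hom SLAT n m) (slat_tuple x).
  apply: slat_tuple_unique => j.
  have /(congr1 (@^~ (slat_tuple x))) /= <- :=
    fmap_comp G (slat_proj j : @hom SLAT m 1%N) (B : @hom SLAT n m).
  by congr (fmap G _ _); apply: funext => i; exact: finset.big_set1.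
have /(congr1 (@^~ (slat_tuple x))) /= <- :=
  fmap_comp G ((fun=> A) : @hom SLAT m 1%N) (B : @hom SLAT n m).
by [].
Qed.

Definition pair2 (T : Type) (x y : T) : 'I_2 -> T :=
  fun i => if i == ord0 then x else y.

Definition tuple0 (T : Type) (i : 'I_0) : T :=
  match notF (ltn_ord i) with end.

Definition slat_set_add (x y : G 1%N) : G 1%N := slat_op [set: 'I_2]%SET (pair2 x y).
Definition slat_set_zero : G 1%N := slat_op finset.set0 (@tuple0 (G 1%N)).

Lemma slat_opU n (A B : {set 'I_n}) x :
  slat_op (A :|: B)%SET x = slat_set_add (slat_op A x) (slat_op B x).
Proof.
have -> : (A :|: B = \bigcup_(j in [set: 'I_2]) pair2 A B j)%SET.
  by rewrite (eq_bigl xpredT) => [|j]; rewrite ?inE // big_ord_recl big_ord1.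
rewrite slat_op_bigcup; congr slat_op.
by apply: funext => j; rewrite /pair2; case: ifP.
Qed.

Lemma slat_op0 n (x : 'I_n -> G 1%N) : slat_op finset.set0 x = slat_set_zero.
Proof.
have -> : finset.set0 = (\bigcup_(j in finset.set0) @tuple0 {set 'I_n} j)%SET.
  by rewrite big_ord0.
by rewrite slat_op_bigcup; congr slat_op; apply: funext => -[].
Qed.

(** The axioms hold because they hold between sets of variables. *)
Definition slat_set_semilattice : semilattice (G 1%N).
Proof.
refine (@Semilattice (G 1%N) slat_set_add slat_set_zero _ _ _ _).
- move=> x y z; pose v : 'I_3 -> G 1%N := fun i => nth x [:: x; y; z] i.
  have -> : x = slat_op [set inord 0]%SET v by rewrite slat_op1 /v inordK.
  have -> : y = slat_op [set inord 1]%SET v by rewrite slat_op1 /v inordK.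
  have -> : z = slat_op [set inord 2]%SET v by rewrite slat_op1 /v inordK.
  by rewrite -!slat_opU finset.setUA.
- move=> x y; pose v := pair2 x y.
  have -> : x = slat_op [set ord0]%SET v by rewrite slat_op1.
  have -> : y = slat_op [set ord_max]%SET v by rewrite slat_op1.
  by rewrite -!slat_opU finset.setUC.
- move=> x; pose v (_ : 'I_1) := x; rewrite -(slat_op0 v).
  have -> : x = slat_op [set ord0]%SET v by rewrite slat_op1.
  by rewrite -slat_opU finset.set0U.
- move=> x; pose v (_ : 'I_1) := x.
  have -> : x = slat_op [set ord0]%SET v by rewrite slat_op1.
  by rewrite -slat_opU finset.setUid.
Defined.

Lemma slat_op_sum n (A : {set 'I_n}) x :
  slat_op A x =
  \big[sadd slat_set_semilattice/szero slat_set_semilattice]_(i in A) x i.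
Proof.
transitivity (slat_op (\bigcup_(i in A) [set i])%SET x).
  congr slat_op; apply/setP => i; apply/idP/finset.bigcupP => [iA|[j jA]].
    by exists i; rewrite ?inE.
  by rewrite inE => /eqP ->.
rewrite (big_morph (fun B => slat_op B x)
  (op1 := sadd slat_set_semilattice) (id1 := szero slat_set_semilattice)).
- by apply: eq_bigr => i _; exact: slat_op1.
- by move=> B B'; exact: slat_opU.
- exact: slat_op0.
Qed.

Lemma slat_set_addE (x y : G 1%N) (w : G 2%N) :
  fmap G (slat_proj ord0) w = x -> fmap G (slat_proj ord_max) w = y ->
  fmap G slat_add w = slat_set_add x y.
Proof.
move=> wx wy; rewrite /slat_set_add /slat_op (@slat_tuple_unique _ _ w) // => i.
rewrite /pair2; case: eqP => [->//|/eqP i0].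
suff -> : i = ord_max by [].
by apply: val_inj; case: i i0 => [[|[|]]].
Qed.

Lemma slat_set_zeroE (w : G 0%N) : fmap G slat_zero w = slat_set_zero.
Proof. by rewrite /slat_set_zero /slat_op (@slat_tuple_unique _ _ w) // => -[]. Qed.

End SlatSet.

Lemma slat_set_hom (G G' : functor SLAT SET) (GP : slat_set G)
    (GP' : slat_set G') (al : nattrans G G') :
  semilattice_hom (slat_set_semilattice GP) (slat_set_semilattice GP') (al 1%N).
Proof.
have nat n m (f : @hom SLAT n m) (w : G n) :
    al m (fmap G f w) = fmap G' f (al n w).
  by have /(congr1 (@^~ w)) := naturality al f.
split=> [x y|]; apply: esym.
  rewrite /= /slat_set_add {2}/slat_op nat.
  by apply: esym; apply: slat_set_addE; rewrite -nat slat_tupleP.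
by rewrite /= {2}/slat_set_zero /slat_op nat (slat_set_zeroE GP').
Qed.

(** * From models to internal categories *)

Definition objects : functor CAT SET.
Proof. by refine (@Functor CAT SET obj on_obj _ _). Defined.

Definition arrows : functor CAT SET.
Proof. by refine (@Functor CAT SET arr on_arr _ _). Defined.

(** By preservation of products [M n] is a product of [n] copies of [M 1%N], hence
    isomorphic to the explicit power, whose objects and arrows are tuples. *)
Lemma model_tuple (M : model CAT) (n : nat) :
  exists u : catfun (power_cat (M 1%N) n) (M n),
    (forall i, catfun_comp (fmap M (slat_proj i)) u = power_proj (M 1%N) i) /\
    catfun_comp u (power_tuple (fun i => fmap M (slat_proj i))) =
      catfun_id (M n).
Proof.
have MP : @is_product CAT n (fun=> M 1%N) (M n) (fun i => fmap M (slat_proj i)).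
  by apply: model_prod; exact: slat_proj_is_product.
have [u [uP uU]] := MP _ (@power_proj (M 1%N) n).
exists u; split=> //.
have [w [_ wU]] := MP (M n) (fun i => fmap M (slat_proj i)).
rewrite -(wU (catfun_id (M n))); last by move=> i; exact: (@compm1 CAT).
apply/esym/wU => i.
transitivity (catfun_comp (power_proj (M 1%N) i)
  (power_tuple (fun i => fmap M (slat_proj i)))); last exact: catfun_eq.
by rewrite -uP; exact: (@compmA CAT).
Qed.

Lemma model_objects (M : model CAT) : slat_set (functor_comp objects M).
Proof.
move=> n x; have [u [uP uK]] := model_tuple M n.
exists (on_obj u x); split=> [i|w wx] /=.
  exact: proj1 (catfun_eqE (uP i)) x.
rewrite -[RHS](proj1 (catfun_eqE uK) w) /=; congr on_obj.
by apply: funext => i; rewrite -wx.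
Qed.

Lemma model_arrows (M : model CAT) : slat_set (functor_comp arrows M).
Proof.
move=> n x; have [u [uP uK]] := model_tuple M n.
exists (on_arr u x); split=> [i|w wx] /=.
  exact: proj2 (catfun_eqE (uP i)) x.
rewrite -[RHS](proj2 (catfun_eqE uK) w) /=; congr on_arr.
by apply: funext => i; rewrite -wx.
Qed.

Section Internal.
Variable M : model CAT.

Let dom_nat : nattrans (functor_comp arrows M) (functor_comp objects M).
Proof.
refine (@NatTrans _ _ (functor_comp arrows M) (functor_comp objects M)
  (fun n => @dom (M n)) _).
by move=> n m f; apply: funext => a /=; exact: dom_on_arr.
Defined.

Let cod_nat : nattrans (functor_comp arrows M) (functor_comp objects M).
Proof.
refine (@NatTrans _ _ (functor_comp arrows M) (functor_comp objects M)
  (fun n => @cod (M n)) _).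
by move=> n m f; apply: funext => a /=; exact: cod_on_arr.
Defined.

Let ident_nat : nattrans (functor_comp objects M) (functor_comp arrows M).
Proof.
refine (@NatTrans _ _ (functor_comp objects M) (functor_comp arrows M)
  (fun n => @ident (M n)) _).
by move=> n m f; apply: funext => x /=; rewrite on_arr_ident.
Defined.

Lemma model_obj_inj n (w w' : obj (M n)) :
  (forall i, on_obj (fmap M (slat_proj i)) w = on_obj (fmap M (slat_proj i)) w') ->
  w = w'.
Proof.
move=> ww'; have [v [_ vU]] := model_objects (n := n)
  (fun i => on_obj (fmap M (slat_proj i)) w').
by rewrite -(vU w) // -(vU w').
Qed.

Lemma model_arr_inj n (w w' : arr (M n)) :
  (forall i, on_arr (fmap M (slat_proj i)) w = on_arr (fmap M (slat_proj i)) w') ->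
  w = w'.
Proof.
move=> ww'; have [v [_ vU]] := model_arrows (n := n)
  (fun i => on_arr (fmap M (slat_proj i)) w').
by rewrite -(vU w) // -(vU w').
Qed.

(** Composition is a homomorphism because [M] sends the addition to a functor:
    pairs of composable arrows are composable arrows in [M 2%N]. *)
Lemma model_compose_add (g f g' f' : arr (M 1%N)) (e : dom g = cod f)
    (e' : dom g' = cod f')
    (e'' : dom (slat_set_add (model_arrows (M := M)) g g') =
           cod (slat_set_add (model_arrows (M := M)) f f')) :
  compose _ _ e'' =
  slat_set_add (model_arrows (M := M)) (compose g f e) (compose g' f' e').
Proof.
pose wg := slat_tuple (model_arrows (M := M)) (pair2 g g') : arr (M 2%N).
pose wf := slat_tuple (model_arrows (M := M)) (pair2 f f') : arr (M 2%N).
have wgP i : on_arr (fmap M (slat_proj i)) wg = pair2 g g' i.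
  exact: (slat_tupleP (model_arrows (M := M))).
have wfP i : on_arr (fmap M (slat_proj i)) wf = pair2 f f' i.
  exact: (slat_tupleP (model_arrows (M := M))).
have we : dom wg = cod wf.
  apply: model_obj_inj => i; rewrite -dom_on_arr -cod_on_arr wgP wfP.
  by rewrite /pair2; case: ifP.
have eP i : dom (on_arr (fmap M (slat_proj i)) wg) =
            cod (on_arr (fmap M (slat_proj i)) wf).
  by rewrite dom_on_arr cod_on_arr we.
apply: etrans (slat_set_addE (model_arrows (M := M)) (w := compose wg wf we) _ _).
- have e2 : dom (on_arr (fmap M slat_add) wg) = cod (on_arr (fmap M slat_add) wf).
    by rewrite dom_on_arr cod_on_arr we.
  rewrite /= (on_arr_compose we e2) -!pcompE; apply: esym.
  by congr pcomp; apply: slat_set_addE; rewrite /= ?wgP ?wfP.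
- by rewrite /= (on_arr_compose we (eP _)) -!pcompE wgP wfP.
- by rewrite /= (on_arr_compose we (eP _)) -!pcompE wgP wfP.
Qed.

Let ident_hom :=
  slat_set_hom (model_objects (M := M)) (model_arrows (M := M)) ident_nat.

(** The zero arrow is an identity. *)
Lemma model_compose_zero
    (e : dom (slat_set_zero (model_arrows (M := M)) : arr (M 1%N)) =
         cod (slat_set_zero (model_arrows (M := M)) : arr (M 1%N))) :
  compose _ _ e = slat_set_zero (model_arrows (M := M)).
Proof.
have [_ /= zeroE] := ident_hom.
by rewrite -pcompE -zeroE -[X in pcomp (ident X)]cod_ident pcomp1f.
Qed.

Definition internal_slatcat : slatcat :=
  @SlatCat (M 1%N) (slat_set_semilattice (model_objects (M := M)))
    (slat_set_semilattice (model_arrows (M := M)))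
    (slat_set_hom _ _ dom_nat) (slat_set_hom _ _ cod_nat) ident_hom
    model_compose_add model_compose_zero.

End Internal.

Lemma naturality_obj (M N : model CAT) (al : nattrans M N) n m
    (f : @hom SLAT n m) (w : obj (M n)) :
  on_obj (al m) (on_obj (fmap M f) w) = on_obj (fmap N f) (on_obj (al n) w).
Proof. exact: proj1 (catfun_eqE (naturality al f)) w. Qed.

Lemma naturality_arr (M N : model CAT) (al : nattrans M N) n m
    (f : @hom SLAT n m) (w : arr (M n)) :
  on_arr (al m) (on_arr (fmap M f) w) = on_arr (fmap N f) (on_arr (al n) w).
Proof. exact: proj2 (catfun_eqE (naturality al f)) w. Qed.

Definition internal_map (M N : model CAT) (al : nattrans M N) :
  slatfun (internal_slatcat M) (internal_slatcat N).
Proof.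
refine (@SlatFun (internal_slatcat M) (internal_slatcat N) (al 1%N) _ _).
- refine (slat_set_hom (model_objects (M := M)) (model_objects (M := N))
    (@NatTrans _ _ (functor_comp objects M) (functor_comp objects N)
      (fun n => on_obj (al n)) _)).
  by move=> n m f; apply: funext => w; exact: naturality_obj.
- refine (slat_set_hom (model_arrows (M := M)) (model_arrows (M := N))
    (@NatTrans _ _ (functor_comp arrows M) (functor_comp arrows N)
      (fun n => on_arr (al n)) _)).
  by move=> n m f; apply: funext => w; exact: naturality_arr.
Defined.

Definition internal : functor (Mod CAT) SLATCAT.
Proof.
by refine (@Functor (Mod CAT) SLATCAT internal_slatcat internal_map _ _) => *;
   exact: slatfun_eq.
Defined.

(** * Internal categories as models *)

Definition diagonal1 (C : smallcat) : catfun C (power_cat C 1) :=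
  power_tuple (fun=> catfun_id C).

Lemma big_ord2 (T : Type) (S : semilattice T) (w : 'I_2 -> T) :
  \big[sadd S/szero S]_(i in [set: 'I_2]%SET) w i = sadd S (w ord0) (w ord_max).
Proof.
rewrite (eq_bigl xpredT) => [|j]; last by rewrite inE.
rewrite big_ord_recl big_ord1; congr (sadd S _ (w _)).
exact: val_inj.
Qed.

Lemma big_set1_eq (T : Type) (S : semilattice T) n (w : 'I_n -> T) j x :
  (fun _ : 'I_1 => \big[sadd S/szero S]_(i in [set j]%SET) w i) = (fun=> x) ->
  w j = x.
Proof. by move=> /(congr1 (@^~ ord0)); rewrite finset.big_set1. Qed.

Lemma diagonal1_identifies (C : slatcat) :
  @identifies (model_of_slatcat C) C (diagonal1 C).
Proof.
split.
- exists (power_proj C ord0); split; first exact: catfun_eq.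
  by apply: catfun_eq => [x|a]; apply: funext => i; rewrite (ord1 i).
- move=> x y w w0 w1; apply: funext => i /=.
  by rewrite big_ord2 (big_set1_eq w0) (big_set1_eq w1).
- move=> x y w w0 w1; apply: funext => i /=.
  by rewrite big_ord2 (big_set1_eq w0) (big_set1_eq w1).
- by move=> w; apply: funext => i; exact: finset.big_set0.
- by move=> w; apply: funext => i; exact: finset.big_set0.
Qed.

(** The hypotheses say that [phi] is a homomorphism for the operations that the
    model induces on [M 1%N]. *)
Definition identification (M : model CAT) (C : slatcat) (phi : catfun C (M 1%N))
  (phiP : identifies phi) : slatfun C (internal_slatcat M).
Proof.
case: phiP => _ oD aD o0 a0.
refine (@SlatFun C (internal_slatcat M) phi _ _); split=> [x y|].
- by rewrite -(oD x y (slat_tuple (model_objects (M := M))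
    (pair2 (on_obj phi x) (on_obj phi y))) _ _) //;
     exact: (slat_tupleP (model_objects (M := M))).
- by rewrite -(o0 (slat_tuple (model_objects (M := M)) (@tuple0 _)));
     exact: (slat_set_zeroE (model_objects (M := M))).
- by rewrite -(aD x y (slat_tuple (model_arrows (M := M))
    (pair2 (on_arr phi x) (on_arr phi y))) _ _) //;
     exact: (slat_tupleP (model_arrows (M := M))).
- by rewrite -(a0 (slat_tuple (model_arrows (M := M)) (@tuple0 _)));
     exact: (slat_set_zeroE (model_arrows (M := M))).
Defined.

Definition model_unit (C : slatcat) :
    slatfun C (internal_slatcat (model_of_slatcat C)) :=
  identification (diagonal1_identifies C).

Lemma model_unitE (C : slatcat) : model_unit C = diagonal1 C :> catfun _ _.
Proof. by rewrite /model_unit /identification; case: diagonal1_identifies. Qed.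

Section Transpose.
Variables (C : slatcat) (M : model CAT) (H : slatfun C (internal_slatcat M)).

Definition transpose_fun n : catfun (power_cat C n) (M n) :=
  catfun_comp (sval (cid (model_tuple M n))) (@power_map C (M 1%N) H n).

Lemma transpose_proj_obj n (x : 'I_n -> obj C) i :
  on_obj (fmap M (slat_proj i)) (on_obj (transpose_fun n) x) = on_obj H (x i).
Proof.
rewrite /transpose_fun; case: cid => u /= [uP _].
exact: proj1 (catfun_eqE (uP i)) (fun i => on_obj H (x i)).
Qed.

Lemma transpose_proj_arr n (a : 'I_n -> arr C) i :
  on_arr (fmap M (slat_proj i)) (on_arr (transpose_fun n) a) = on_arr H (a i).
Proof.
rewrite /transpose_fun; case: cid => u /= [uP _].
exact: proj2 (catfun_eqE (uP i)) (fun i => on_arr H (a i)).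
Qed.

Definition transpose : nattrans (model_of_slatcat C) M.
Proof.
refine (@NatTrans SLAT CAT (model_of_slatcat C) M transpose_fun _).
move=> n m f.
have proj_f i : slat_proj i \oc f = ((fun=> f i) : @hom SLAT n 1%N).
  by apply: funext => j; exact: finset.big_set1.
apply: catfun_eq => [x|a].
- apply: model_obj_inj => i; rewrite [LHS]transpose_proj_obj.
  transitivity (slat_op (model_objects (M := M)) (f i) (fun j => on_obj H (x j))).
    apply: etrans (semilattice_hom_big _ _ (on_obj_slat H)) (esym _).
    exact (slat_op_sum (model_objects (M := M)) (f i) (fun j => on_obj H (x j))).
  rewrite /slat_op.
  rewrite (@slat_tuple_unique _ (model_objects (M := M)) _ _
    (on_obj (transpose_fun n) x)); last exact: transpose_proj_obj.
  rewrite -proj_f; exact: proj1 (catfun_eqE (fmap_comp M (slat_proj i) f)) _.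
- apply: model_arr_inj => i; rewrite [LHS]transpose_proj_arr.
  transitivity (slat_op (model_arrows (M := M)) (f i) (fun j => on_arr H (a j))).
    apply: etrans (semilattice_hom_big _ _ (on_arr_slat H)) (esym _).
    exact (slat_op_sum (model_arrows (M := M)) (f i) (fun j => on_arr H (a j))).
  rewrite /slat_op.
  rewrite (@slat_tuple_unique _ (model_arrows (M := M)) _ _
    (on_arr (transpose_fun n) a)); last exact: transpose_proj_arr.
  rewrite -proj_f; exact: proj2 (catfun_eqE (fmap_comp M (slat_proj i) f)) _.
Defined.

Lemma slat_proj_id : slat_proj (ord0 : 'I_1) = idm (1%N : SLAT).
Proof. by apply: funext => i; rewrite (ord1 i). Qed.

Lemma transpose_unit :
  slatfun_comp (internal_map transpose) (model_unit C) = H.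
Proof.
apply: slatfun_eq => [x|a] /=; rewrite model_unitE /=.
- rewrite -[RHS](transpose_proj_obj (fun=> x) (ord0 : 'I_1)) slat_proj_id.
  exact: esym (proj1 (catfun_eqE (fmap_id M (1%N : SLAT))) _).
- rewrite -[RHS](transpose_proj_arr (fun=> a) (ord0 : 'I_1)) slat_proj_id.
  exact: esym (proj2 (catfun_eqE (fmap_id M (1%N : SLAT))) _).
Qed.

Lemma transpose_unique (al : nattrans (model_of_slatcat C) M) :
  slatfun_comp (internal_map al) (model_unit C) = H -> transpose = al.
Proof.
move=> /(congr1 (@slat_catfun _ _))/catfun_eqE[] /=; rewrite model_unitE => Ho Ha.
apply: nattrans_eq => n; apply: catfun_eq => [x|a].
- apply: model_obj_inj => i; rewrite [LHS]transpose_proj_obj -Ho.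
  apply: etrans (naturality_obj al (slat_proj i) x); congr (on_obj (al 1%N)).
  by apply: funext => j; rewrite /= finset.big_set1.
- apply: model_arr_inj => i; rewrite [LHS]transpose_proj_arr -Ha.
  apply: etrans (naturality_arr al (slat_proj i) a); congr (on_arr (al 1%N)).
  by apply: funext => j; rewrite /= finset.big_set1.
Qed.

End Transpose.

Lemma model_of_left_adjoint : is_left_adjoint model_of.
Proof.
apply: (@left_adjoint_of_universal SLATCAT (Mod CAT) model_of internal model_unit).
  by move=> C D H; apply: slatfun_eq => [x|a] /=; rewrite !model_unitE.
move=> C M H; exists (transpose H); split; first exact: transpose_unit.
by move=> al; exact: transpose_unique.
Qed.

Theorem proposition6p7
    (L : functor SET (Mod SET)) (a : adjunction L (underlying SET))
    (ha : monad_is_pow a) :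
  exists F : functor SLATNet (Mod CAT),
    is_left_adjoint F /\
    exists phi : forall P : net, catfun (free_slatcat P) (F P 1%N),
      (forall P : net, identifies (phi P)) /\
      (forall (P Q : net) (h : net_hom P Q),
        exists H : slatfun (free_slatcat P) (free_slatcat Q),
          [/\ extends h H,
              forall H' : slatfun (free_slatcat P) (free_slatcat Q),
                extends h H' -> H' = H
            & catfun_comp (component (fmap F h) 1%N) (phi P) =
              catfun_comp (phi Q) H]).
Proof.
exists (functor_comp model_of free); split.
  exact: is_left_adjoint_comp free_left_adjoint model_of_left_adjoint.
exists (fun P => diagonal1 (free_slatcat P)); split.
  by move=> P; exact: diagonal1_identifies.
move=> P Q h; exists (free_map h); split.
- exact: free_map_extends.
- exact: free_map_unique.
- exact: catfun_eq.
Qed.
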